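(* Let $m\ge2$ be an integer, $0\le\beta<1$ and $t\in\mathbb{C}\setminus\{0,1\}$. The exponential splines satisfy (i) $\Phi_{m-1}(\beta,t)=\dfrac{(-1)^m}{(m-1)!}G_m\!\left(\dfrac1t,\beta\right)$; (ii) $t(m-1)\Phi_{m-1}(\beta,t)=\big(m-1+\beta(t-1)\big)\Phi_{m-2}(\beta,t)+t(1-t)\Phi_{m-2}'(\beta,t)$, where $'$ denotes differentiation with respect to $t$.
   Context: B-splines: $Q_1=\chi_{[0,1)}$, $Q_{m+1}(x)=\int_{-\infty}^\infty Q_m(x-t)Q_1(t)dt$. Exponential spline of degree $m-1$: $\Phi_{m-1}(\beta,t)=\sum_{k\in\mathbb{Z}}t^kQ_m(\beta-k)$. Polynomials $G_m(t,\beta)$ are defined by $G_1(t,\beta)=-1$ and, for $m\ge2$, $G_m(t,\beta)=[\beta(t-1)-(m-1)t]G_{m-1}(t,\beta)+t(t-1)\frac{\partial}{\partial t}G_{m-1}(t,\beta)$. *)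

(* Defs.v *)
From HB Require Import structures.
From mathcomp Require Import all_boot all_order all_algebra.
From mathcomp Require Import complex.
From mathcomp Require Import all_classical all_reals all_analysis.
Set Implicit Arguments. Unset Strict Implicit. Unset Printing Implicit Defensive.
Import Order.TTheory GRing.Theory Num.Theory numFieldNormedType.Exports.
Local Open Scope ring_scope.
Local Open Scope complex_scope.
Local Open Scope classical_set_scope.

(* equip R[i] with its standard (norm) topology / normed-module structure over itself *)
HB.instance Definition _ (R : rcfType) := NormedModule.copy R[i] (R[i])^o.

Section Defs.
Variable R : realType.

Definition Q1 (x : R) : R := if (0 <= x) && (x < 1) then 1 else 0.

(* Qs n = Q_{n+1};  Q_{m+1}(x) = \int_{-oo}^{oo} Q_m(x-t) Q_1(t) dt  (Lebesgue) *)
Fixpoint Qs (n : nat) : R -> R :=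
  match n with
  | 0%N => Q1
  | n'.+1 => fun x =>
      Rintegral (@lebesgue_measure R) [set: R] (fun t => Qs n' (x - t) * Q1 t)
  end.

(* B-spline Q_m for m >= 1 (Q_0 is not used) *)
Definition Bspline (m : nat) : R -> R := Qs m.-1.

Definition Phi_partial (d : nat) (beta : R) (t : R[i]) (N : nat) : R[i] :=
  \sum_(0 <= i < (N.*2).+1)
     t ^ (i%:Z - N%:Z) * ((Bspline d.+1 (beta - (i%:Z - N%:Z)%:~R))%:C).

(* exponential spline of degree d:  Phi_d(beta,t) = \sum_{k in Z} t^k Q_{d+1}(beta-k) *)
Definition Phi (d : nat) (beta : R) (t : R[i]) : R[i] :=
  limn (Phi_partial d beta t).

Fixpoint Gs (n : nat) (beta : R) : {poly R[i]} :=
  match n with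
  | 0%N => -1
  | n'.+1 => ((beta%:C)%:P * ('X - 1) - (n'.+1)%:R *: 'X) * Gs n' beta
             + 'X * ('X - 1) * (Gs n' beta)^`()
  end.

(* G m beta = G_m(., beta) for m >= 1 *)
Definition G (m : nat) (beta : R) : {poly R[i]} := Gs m.-1 beta.

End Defs.

(* Main.v *)
(* Integrating truncated powers gives the closed form
   Q_(n+1)(x) = 1/n! sum_j (-1)^j C(n+1,j) (x-j)_+^n, and the identities
   C(n+1,j) = C(n,j) + C(n,j-1) and j C(n+1,j) = (n+1) C(n,j-1) turn it into
   n Q_(n+1)(x) = x Q_n(x) + (n+1-x) Q_n(x-1), valid at every point.  Hence Q_n
   vanishes outside [0,n), so for 0 <= beta < 1 the exponential spline is a
   polynomial in 1/t.  Comparing coefficients, the recursion for the Q_n becomes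
   a differential recursion for that polynomial; this is (ii), and it is the
   recursion of the G_m, which gives (i). *)
Require Import Defs.
From HB Require Import structures.
From mathcomp Require Import all_boot all_order all_algebra.
From mathcomp Require Import complex ring lra.
From mathcomp Require Import all_classical all_reals all_analysis.
Import Order.TTheory GRing.Theory Num.Theory numFieldNormedType.Exports.
Local Open Scope ring_scope.
Local Open Scope complex_scope.

Set Implicit Arguments.
Unset Strict Implicit.

(** * Alternating binomial sums *)

Section SignedBinomialSums.
Variable R : comNzRingType.
Implicit Types (f : nat -> R) (x : R) (n : nat).

(** Pascal's rule followed by an index shift. A unit-step difference of [f] is what integration
    against [Q1] produces, so this carries the closed form from [n] to [n.+1]. *)
Lemma sum_sign_binS f n :
  \sum_(0 <= j < n.+2) (-1) ^+ j * 'C(n.+1, j)%:R * f j =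
  \sum_(0 <= j < n.+1) (-1) ^+ j * 'C(n, j)%:R * (f j - f j.+1).
Proof.
under [RHS]eq_bigr do rewrite mulrBr; rewrite sumrB.
have -> : \sum_(0 <= j < n.+1) (-1) ^+ j * 'C(n, j)%:R * f j =
    \sum_(0 <= j < n.+2) (-1) ^+ j * 'C(n, j)%:R * f j.
  by rewrite [RHS]big_nat_recr //= bin_small // mulr0 mul0r addr0.
rewrite [LHS]big_nat_recl // [X in _ = X - _]big_nat_recl // !bin0 -addrA.
congr (_ + _).
rewrite -sumrB; apply: eq_bigr => j _.
rewrite binS natrD exprS; ring.
Qed.

(** Pascal's rule handles the part with factor [x], and the absorption identity [diag] the part with
    factor [j]. The shifted sum will become the spline at [x - 1]. *)
Lemma sum_sign_binS_linear f x n :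
  \sum_(0 <= j < n.+3) (-1) ^+ j * 'C(n.+2, j)%:R * ((x - j%:R) * f j) =
  x * (\sum_(0 <= j < n.+2) (-1) ^+ j * 'C(n.+1, j)%:R * f j) +
  (n.+2%:R - x) * (\sum_(0 <= j < n.+2) (-1) ^+ j * 'C(n.+1, j)%:R * f j.+1).
Proof.
have -> : \sum_(0 <= j < n.+2) (-1) ^+ j * 'C(n.+1, j)%:R * f j =
    \sum_(0 <= j < n.+3) (-1) ^+ j * 'C(n.+1, j)%:R * f j.
  by rewrite [RHS]big_nat_recr //= bin_small // mulr0 mul0r addr0.
rewrite [LHS]big_nat_recl // [X in _ = _ * X + _]big_nat_recl // !bin0 mulrDr.
rewrite -addrA; congr (_ + _).
  by rewrite expr0 subr0; ring.
rewrite !mulr_sumr -big_split; apply: eq_bigr => j _ /=.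
have diag : (j.+1)%:R * 'C(n.+2, j.+1)%:R = n.+2%:R * 'C(n.+1, j)%:R :> R.
  by rewrite -!natrM -mul_bin_diag.
transitivity (- (-1) ^+ j * (x * 'C(n.+2, j.+1)%:R
    - j.+1%:R * 'C(n.+2, j.+1)%:R) * f j.+1).
  rewrite exprS; ring.
rewrite diag binS natrD exprS; ring.
Qed.

End SignedBinomialSums.

(** * Closed form, recursion and support of the B-splines *)

Section Bsplines.
Variable R : realType.
Implicit Types (x a c : R) (n : nat).
Notation mu := (@lebesgue_measure R).

(* At [n = 0] this is the indicator of [0 <= x], matching the half-open [Q1]. *)
Definition truncpow n x : R := if 0 <= x then x ^+ n else 0.

Lemma truncpowS n x : truncpow n.+1 x = x * truncpow n x.
Proof. by rewrite /truncpow; case: ifP => _; rewrite ?mulr0 ?exprS. Qed.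

Lemma integrable_subX n a c :
  mu.-integrable `[0, c]%classic (EFin \o (fun t => (a - t) ^+ n)).
Proof.
have -> : (fun t => (a - t) ^+ n) = horner ((a%:P - 'X) ^+ n).
  by apply/funext => t; rewrite !hornerE.
apply: continuous_compact_integrable; first exact: segment_compact.
exact/continuous_subspaceT/continuous_horner.
Qed.

Lemma Rintegral_subX n a c : 0 <= c ->
  \int[mu]_(t in `[0, c]%classic) (a - t) ^+ n =
  (a ^+ n.+1 - (a - c) ^+ n.+1) / n.+1%:R.
Proof.
rewrite le_eqVlt => /predU1P[<-|c0].
  by rewrite set_itv1 Rintegral_set1 subr0 subrr mul0r.
pose f : {poly R} := (a%:P - 'X) ^+ n.
pose F : {poly R} := - (n.+1%:R)^-1 *: (a%:P - 'X) ^+ n.+1.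
have -> : (fun t => (a - t) ^+ n) = horner f.
  by apply/funext => t; rewrite !hornerE.
have dF : F^`() = f.
  rewrite /F derivZ deriv_exp derivB derivC derivX sub0r mulN1r scaleNr /=.
  rewrite mulNrn scalerN opprK -[X in _ *: X]scaler_nat scalerA.
  by rewrite mulVf ?scale1r // pnatr_eq0.
rewrite /Rintegral (continuous_FTC2 (F := horner F)) //=.
- rewrite /F !hornerE subr0 !mulNr opprK addrC mulrC [X in _ - X]mulrC.
  by rewrite -mulrBl.
- exact/continuous_subspaceT/continuous_horner.
- split=> [y _||].
  + exact: derivable_horner.
  + exact/cvg_at_right_filter/continuous_horner.
  + exact/cvg_at_left_filter/continuous_horner.
- by move=> y _; rewrite -derivE dF.
Qed.

(** The integrand is [(a - t) ^+ n] cut down to an interval: empty if a < 0, [0, a] if 0 <= a < 1,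
    and [0, 1) if a >= 1. Integrability is recorded because linearity of the integral needs it. *)
Lemma truncpow_mulQ1 n a :
  mu.-integrable setT (EFin \o (fun t => truncpow n (a - t) * Q1 t)) /\
  \int[mu]_t (truncpow n (a - t) * Q1 t) =
  (truncpow n.+1 a - truncpow n.+1 (a - 1)) / n.+1%:R.
Proof.
pose g (t : R) := (a - t) ^+ n.
have restrE (A : set (measurableTypeR R)) :
    (fun t => truncpow n (a - t) * Q1 t) = g \_ A ->
    measurable A -> mu.-integrable A (EFin \o g) ->
    mu.-integrable setT (EFin \o (fun t => truncpow n (a - t) * Q1 t)) /\
    \int[mu]_t (truncpow n (a - t) * Q1 t) = \int[mu]_(t in A) g t.
  move=> -> mA ig; split; last by rewrite [RHS]Rintegral_mkcond.
  by rewrite -restrict_EFin; exact: (iffLR (integrable_mkcond _ mA) ig).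
have [a0|a0] := ltP a 0.
  case: (restrE set0) => [||| i ->].
  - apply/funext => t; rewrite patchE in_set0 /truncpow /Q1.
    case: ifP => at0; last by rewrite mul0r.
    by rewrite ifF ?mulr0 //; apply/negbTE/negP => /andP[t0 _]; lra.
  - exact: measurable0.
  - exact: integrable_set0.
  - split=> //; rewrite Rintegral_set0 /truncpow.
    by rewrite !lt_geF ?subrr ?mul0r //; lra.
have [a1|a1] := ltP a 1.
  case: (restrE `[0, a]%classic) => [||| i ->].
  - apply/funext => t; rewrite patchE mem_setE in_itv /= /truncpow /Q1 subr_ge0.
    have [t0|] := boolP (0 <= t); last by rewrite mulr0.
    case: (leP t a) => ta; last by rewrite mul0r.
    by rewrite (le_lt_trans ta a1) mulr1.
  - exact: measurable_itv.
  - exact: integrable_subX.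
  - split=> //; rewrite Rintegral_subX // /truncpow a0 lt_geF ?subr_lt0 //.
    by rewrite subrr expr0n.
have i1 := integrable_subX n a 1.
have i2 : mu.-integrable `[0, 1[%classic (EFin \o g).
  apply: integrableS i1 => //.
  by apply: subset_itvl; rewrite bnd_simp.
case: (restrE `[0, 1[%classic) => [||| i ->].
- apply/funext => t; rewrite patchE mem_setE in_itv /= /truncpow /Q1 subr_ge0.
  have [/andP[t0 t1]|_] := boolP ((0 <= t) && (t < 1)); last by rewrite mulr0.
  by rewrite (le_trans (ltW t1) a1) mulr1.
- exact: measurable_itv.
- exact: i2.
- split=> //; rewrite Rintegral_itv_bndo_bndc // Rintegral_subX //.
  by rewrite /truncpow a0 subr_ge0 a1.
Qed.

Lemma Qs_truncpow n x : Qs n x =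
  (n`!)%:R^-1 *
  \sum_(0 <= j < n.+2) (-1) ^+ j * 'C(n.+1, j)%:R * truncpow n (x - j%:R).
Proof.
elim: n x => [|n ih] x.
  rewrite invr1 mul1r big_nat_recl // big_nat1 /= /Q1 /truncpow !subr_ge0 subr0.
  rewrite bin0 binn.
  by case: (leP 0 x) => x0; case: (ltP x 1) => x1 /=; lra.
transitivity (\int[mu]_t \sum_(0 <= j < n.+2)
    ((n`!)%:R^-1 * ((-1) ^+ j * 'C(n.+1, j)%:R)
      * (truncpow n (x - j%:R - t) * Q1 t))).
  apply: eq_Rintegral => t _; rewrite -/(Qs n (x - t)) ih mulr_sumr mulr_suml.
  by apply: eq_bigr => j _; rewrite (addrAC x) !mulrA.
have term c a : mu.-integrable setT
    (EFin \o (fun t => c * (truncpow n (a - t) * Q1 t))).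
  rewrite (_ : _ \o _ = fun t => (c%:E * (truncpow n (a - t) * Q1 t)%:E)%E) //.
  by apply: integrableZl => //; have [] := truncpow_mulQ1 n a.
rewrite /Rintegral.
under eq_integral do rewrite -sumEFin.
rewrite integral_sum //; last by move=> j; exact: term.
rewrite -sum_fine; last by move=> j _; apply: integrable_fin_num (term _ _).
(* Rewriting the target sum by differences makes the two sides agree term by term: each integral is
   a difference of consecutive truncated powers. *)
rewrite sum_sign_binS mulr_sumr; apply: eq_bigr => j _.
rewrite -[fine _]/(Rintegral _ _ _) RintegralZl //; last first.
  by have [] := truncpow_mulQ1 n (x - j%:R).
have [_ ->] := truncpow_mulQ1 n (x - j%:R).
have -> : x - j%:R - 1 = x - j.+1%:R by rewrite -natr1; ring.
rewrite factS natrM; field.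
by rewrite nat1r !pnatr_eq0 -lt0n fact_gt0.
Qed.

Lemma Qs_rec n x : n.+1%:R * Qs n.+1 x =
  x * Qs n x + (n.+2%:R - x) * Qs n (x - 1) :> R.
Proof.
rewrite !Qs_truncpow.
under eq_bigr do rewrite truncpowS.
rewrite (sum_sign_binS_linear (fun j => truncpow n (x - j%:R))) /=.
under [X in _ = _ + _ * (_ * X)]eq_bigr => j _.
  rewrite -addrA -opprD nat1r; over.
rewrite factS natrM; field.
by rewrite nat1r !pnatr_eq0 -lt0n fact_gt0.
Qed.

Lemma Qs_lt0 n x : x < 0 -> Qs n x = 0.
Proof.
move=> x0; rewrite Qs_truncpow big1 ?mulr0 // => j _.
by rewrite /truncpow lt_geF ?mulr0 // subr_lt0 (lt_le_trans x0).
Qed.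

(** Induction through [Qs_rec] avoids showing that the (n+1)-st differences of a polynomial of
    degree n vanish: both [x] and [x - 1] lie past the previous support. *)
Lemma Qs_ge n x : n.+1%:R <= x -> Qs n x = 0.
Proof.
elim: n x => [|n ih] x nx; first by rewrite /= /Q1 ltNge nx andbF.
apply: (mulfI (_ : n.+1%:R != 0)); first by rewrite pnatr_eq0.
rewrite Qs_rec !ih ?mulr0 ?addr0 //.
  by rewrite lerBrDr natr1.
by rewrite (le_trans _ nx) // ler_nat.
Qed.

End Bsplines.

Lemma is_derive_hornerV (K : numFieldType) (p : {poly K}) (z : K) : z != 0 ->
  is_derive z (1 : K) (fun y => p.[y^-1]) (- z ^- 2 * p^`().[z^-1]).
Proof.
move=> z0; have dV : is_derive z (1 : K) (fun y : K => y^-1) (- z ^- 2).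
  apply: DeriveDef; first exact: derivableV.
  by rewrite deriveV // derive_id [LHS]mulr1.
elim/poly_ind: p => [|p c ih].
  rewrite (_ : (fun y => _) = cst 0); last first.
    by apply/funext => y; rewrite horner0.
  by rewrite deriv0 horner0 mulr0; exact: is_derive_cst.
rewrite (_ : (fun y => _) =
    (fun y => p.[y^-1]) * (fun y => y^-1) + cst c); last first.
  by apply/funext => y; rewrite !hornerE.
apply: is_derive_eq; rewrite addr0 derivD derivM derivX derivC !hornerE.
rewrite /GRing.scale /=; ring.
Qed.

(** * Exponential splines as polynomials in 1/t *)

Section ExponentialSplines.
Variables (R : realType) (beta : R).
Hypotheses (b0 : 0 <= beta) (b1 : beta < 1).
Implicit Types n : nat.

(* [Phi n beta t] is this polynomial at [t^-1]; with [z^-1 = 0] at [z = 0] this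
   holds for every [t]. *)
Definition Phipoly n : {poly R[i]} :=
  \poly_(j < n.+1) (Qs n (beta + j%:R))%:C.

Lemma Phi_partialE n (t : R[i]) N : (n <= N)%N ->
  Phi_partial n beta t N = (Phipoly n).[t^-1].
Proof.
move=> nN; rewrite /Phi_partial /Bspline /=.
(* Indices i > N correspond to k = i - N > 0, where beta - k < 0 lies left of the support. *)
rewrite (big_cat_nat (n := N.+1)) //=; last by rewrite -addnn ltnS leq_addr.
rewrite [X in _ + X]big_nat_cond [X in _ + X]big1 ?addr0; last first.
  move=> i /andP[/andP[Ni _] _]; rewrite Qs_lt0 ?mulr0 //.
  rewrite subzn ?(ltnW Ni) // -pmulrn subr_lt0 (lt_le_trans b1) //.
  by rewrite ler1n subn_gt0.
(* After reversal the index is -k; beyond [n] the argument is at least [n.+1], right of the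
   support. *)
rewrite big_nat_rev /= add0n horner_poly.
have idx i : (i <= N)%N -> (N.+1 - i.+1)%N%:Z - N%:Z = - i%:Z.
  by move=> iN; rewrite subSS -subzn // addrAC subrr add0r.
rewrite (big_cat_nat (n := n.+1)) //= [X in _ + X]big_nat_cond.
rewrite [X in _ + X]big1 ?addr0 => [|i /andP[/andP[ni iN] _]].
  rewrite big_mkord; apply: eq_bigr => i _.
  have iN : (i <= N)%N by rewrite (leq_trans _ nN) // -ltnS.
  by rewrite (idx i iN) rmorphN /= opprK exprVn -exprnN mulrC.
rewrite (idx i iN) rmorphN /= opprK Qs_ge ?mulr0 //.
by rewrite (le_trans (_ : _ <= i%:R)) ?ler_nat // lerDr.
Qed.

Lemma PhiE n (t : R[i]) : Phi n beta t = (Phipoly n).[t^-1].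
Proof.
apply: norm_lim_near_cst; exists n => // N /= nN.
exact: Phi_partialE.
Qed.

Lemma derive1_Phi n (t : R[i]) : t != 0 ->
  derive1 (fun z : R[i] => Phi n beta z) t =
  - t ^- 2 * (Phipoly n)^`().[t^-1].
Proof.
move=> t0; rewrite (_ : (fun z => _) = fun z => (Phipoly n).[z^-1]).
  rewrite derive1E.
  by apply: (@derive_val _ _ _ _ _ _ _ (is_derive_hornerV _ t0)).
by apply/funext => z; exact: PhiE.
Qed.

(** The truncation in [Phipoly] is invisible since the spline vanishes past it, so coefficients can
    be compared without degree bounds. *)
Lemma coef_Phipoly n j : (Phipoly n)`_j = (Qs n (beta + j%:R))%:C.
Proof.
rewrite coef_poly; case: ltnP => // nj; rewrite Qs_ge //.
by rewrite (le_trans (_ : _ <= j%:R)) ?ler_nat // lerDr.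
Qed.

(** The coefficient of X^j is [Qs_rec] at beta + j: the operator X d/dX supplies the factor j, and
    multiplication by X the shift to beta + j - 1. *)
Lemma Phipoly_rec n : n.+1%:R *: Phipoly n.+1 =
  (n.+1%:R *: 'X + (beta%:C)%:P * (1 - 'X)) * Phipoly n
  + ('X - 'X ^+ 2) * (Phipoly n)^`().
Proof.
have coefXD j : ('X * (Phipoly n)^`())`_j = j%:R * (Phipoly n)`_j.
  by rewrite coefXM; case: j => [|j] /=; rewrite ?mul0r // coef_deriv mulr_natl.
rewrite [RHS](_ : _ = n.+1%:R *: ('X * Phipoly n)
    + beta%:C *: (Phipoly n - 'X * Phipoly n)
    + ('X * (Phipoly n)^`() - 'X * ('X * (Phipoly n)^`())));
  last first.
  by rewrite -!mul_polyC; ring.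
have natC k : k%:R = (k%:R : R)%:C by rewrite (rmorph_nat (@real_complex R)).
apply/polyP => j; rewrite coefZ coef_Phipoly natC -rmorphM Qs_rec.
rewrite !(coefD, coefZ, coefN) [('X * ('X * _))`_j]coefXM coefXD coefXM.
case: j => [|j] /=.
  (* For j = 0 the shifted term is zero because beta < 1. *)
  rewrite addr0 (@Qs_lt0 _ _ (beta - 1)) ?subr_lt0 // !coef_Phipoly addr0.
  by rewrite mulr0 addr0 rmorphM; ring.
rewrite coefXD !coef_Phipoly.
have -> : beta + j.+1%:R - 1 = beta + j%:R by rewrite -natr1; ring.
rewrite (natC j) (natC j.+1) -!rmorphM -!rmorphB -!rmorphM -!rmorphD.
by congr (_%:C); ring.
Qed.

(** The operator defining [Gs] is the negative of the one in [Phipoly_rec], so each step contributes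
    a factor -1/(n+1). *)
Lemma Phipoly_Gs n :
  Phipoly n = ((-1) ^+ n.+1 / (n`!)%:R) *: Gs n beta.
Proof.
elim: n => [|n ih].
  apply/polyP => j; rewrite coef_poly /= invr1 mulr1 expr1 scaleN1r opprK coef1.
  by case: j => [|j] //=; rewrite addr0 /Q1 b0 b1.
have n0 : n.+1%:R != 0 :> R[i] by rewrite pnatr_eq0.
apply: (scalerI n0); rewrite Phipoly_rec ih derivZ.
rewrite scalerA factS natrM.
have -> : n.+1%:R * ((-1) ^+ n.+2 / (n.+1%:R * (n`!)%:R)) =
    - ((-1) ^+ n.+1 / (n`!)%:R) :> R[i].
  by rewrite exprS; field; rewrite nat1r !pnatr_eq0 -lt0n fact_gt0.
by rewrite /= -!mul_polyC rmorphN /=; ring.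
Qed.

End ExponentialSplines.

Unset Implicit Arguments.
Set Strict Implicit.

Theorem theorem4p5 (R : realType) (m : nat) (beta : R) (t : R[i]) :
  (2 <= m)%N -> 0 <= beta -> beta < 1 -> t != 0 -> t != 1 ->
  Phi (m.-1) beta t = (-1) ^+ m / ((m.-1)`!)%:R * (G m beta).[t^-1]
  /\
  t * (m.-1)%:R * Phi (m.-1) beta t
    = ((m.-1)%:R + (beta%:C) * (t - 1)) * Phi (m - 2) beta t
      + t * (1 - t) * derive1 (fun z : R[i] => Phi (m - 2) beta z) t.
Proof.
case: m => [|[|n]] // _ b0 b1 t0 _; rewrite !subSS subn0 /=; split.
  by rewrite PhiE // Phipoly_Gs // hornerZ.
(* Part (ii) is t times [Phipoly_rec] evaluated at 1/t; the chain-rule factor gives t (1 - t)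
   (-1/t^2) = t (1/t - 1/t^2). *)
rewrite !PhiE // -mulrA -hornerZ Phipoly_rec // !hornerE derive1_Phi //.
by field.
Qed.
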